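(* Let $0<q\le 1$ and $1<p<\infty$. There is a constant $C(q,p)$, depending only on $q$ and $p$, such that for every $n\in\mathbb{N}$ and every normalized system $\mathcal{D}$ of cardinality $|\mathcal{D}|=n$ in a real space $L_p$, and every integer $k\ge 1$, $$ \epsilon_k(A_q(\mathcal{D}),L_p)\le C(q,p)\begin{cases}\left(\dfrac{\log(2n/k)}{k}\right)^{\frac1q-\max\left(\frac12,\frac1p\right)}, & k\le n,\\[2mm] 2^{-k/n}\,n^{\max\left(\frac12,\frac1p\right)-\frac1q}, & k\ge n.\end{cases} $$
   Context: Here $\log:=\log_2$, and $L_p$ denotes the usual Lebesgue space of real-valued functions on a measure space. A system $\mathcal{D}=\{g_j\}_{j=1}^n\subset X$ in a Banach space $X$ is normalized if $\|g_j\|_X=1$ for all $j$. For $q>0$, $A_q(\mathcal{D})$ denotes the closure in $X$ (here $X=L_p$) of the set $$ \Bigl\{x:\ x=\sum_j c_jg_j,\ g_j\in\mathcal{D},\ \sum_j|c_j|^q\le 1\Bigr\}, $$ with scalar coefficients $c_j$. Entropy numbers: for a compact set $A\subset X$, $$ \epsilon_k(A,X):=\inf\Bigl\{\epsilon:\ \exists\, y^1,\dots,y^{2^k}\in X:\ A\subseteq\bigcup_{j=1}^{2^k}B_X(y^j,\epsilon)\Bigr\}, $$ where $B_X(y,\epsilon)=\{x\in X:\|x-y\|\le\epsilon\}$. *)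

(* Defs.v *)
From mathcomp Require Import all_boot all_order all_algebra.
From mathcomp Require Import all_classical all_reals all_analysis.
Set Implicit Arguments.
Unset Strict Implicit.
Unset Printing Implicit Defensive.
Import Order.TTheory GRing.Theory Num.Theory.
Import numFieldNormedType.Exports.
Local Open Scope classical_set_scope.
Local Open Scope ring_scope.

(* The library's type [LspaceType] of a.e.-classes carries no vector space
   structure, so L_p is represented by the vector space [LfunType] of p-integrable
   functions with the seminorm [Lp_norm]; two functions are the same element of L_p
   when they are a.e. equal.  Balls, closures and entropy numbers only involve the
   (semi)norm, so they do not depend on the choice of representatives. *)

Section seminormed_space.
Context {R : realType} {X : lmodType R}.
Variable nrm : X -> R.

Definition norm_cball (y : X) (e : R) : set X := [set x | nrm (x - y) <= e].

Definition norm_closure (A : set X) : set X :=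
  [set x | forall e : R, 0 < e -> exists2 a, A a & nrm (x - a) < e].

(* The infimum is taken in the extended reals, so that it is +oo when no radius is
   admissible (the infimum of the empty set in R is 0 by convention). *)
Definition entropy_number (k : nat) (A : set X) : \bar R :=
  ereal_inf [set e%:E | e in
    [set e : R | exists y : 'I_(2 ^ k) -> X,
                   A `<=` \bigcup_j norm_cball (y j) e]].

Definition normalized_system (n : nat) (g : 'I_n -> X) : Prop :=
  forall j, nrm (g j) = 1.

Definition A_class (q : R) (n : nat) (g : 'I_n -> X) : set X :=
  norm_closure [set x | exists c : 'I_n -> R,
    \sum_(j < n) `|c j| `^ q <= 1 /\ x = \sum_(j < n) c j *: g j].

End seminormed_space.

Lemma lt1_lee1_fin (R : realType) (p : R) : 1 < p -> (1 <= p%:E)%E.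
Proof. by move=> p1; rewrite lee_fin ltW. Qed.

Notation Lp mu p1 := (LfunType mu (lt1_lee1_fin p1)).

Section Lp.
Context {d : measure_display} {T : measurableType d} {R : realType}.
Variables (mu : {measure set T -> \bar R}) (p : R) (p1 : 1 < p).

Definition Lp_norm (f : Lp mu p1) : R := fine ('N[mu]_(p%:E)[EFin \o f])%E.

(* |D| = n for the system D = {g_j : j < n}: its members are n distinct elements
   of L_p, i.e. pairwise not a.e. equal. *)
Definition Lp_distinct (n : nat) (g : 'I_n -> Lp mu p1) : Prop :=
  forall i j, (g i : T -> R) = g j %[ae mu] -> i = j.

End Lp.

Definition log2 (R : realType) (x : R) : R := ln x / ln 2.

(* Main.v *)
Require Import Defs.
From mathcomp Require Import all_boot all_order all_algebra.
From mathcomp Require Import all_classical all_reals all_analysis.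
From mathcomp Require Import measurable_realfun ring lra.
Import Order.TTheory GRing.Theory Num.Theory.
Import numFieldNormedType.Exports.
Local Open Scope classical_set_scope.
Local Open Scope ring_scope.
Set Implicit Arguments.
Unset Strict Implicit.
Unset Printing Implicit Defensive.

(** If [sum_j |c_j|^q <= 1] and [M > 0], round [y_j = M^(1/q) c_j] to an adjacent integer
    [z_j], at random and without bias.  The function [|.|^p] has a first-order expansion
    whose remainder gives [L_p] type [min(p, 2)], so the rounding error has norm
    [O(w^max(1/2,1/p))], where [w >= 1] bounds the sum of the variances; that sum is at
    most [M] and at most [n], while the expectation of [sum_j |z_j|^q] is at most [2 M].
    Hence the points [M^(-1/q) sum_j z_j g_j] with [sum_j |z_j|^q = O(M)] form a net, whose
    cardinality is estimated by a generating function.  For [k <= n] take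
    [M = c k / log2 (2n/k)], with error [O(M^(max(1/2,1/p) - 1/q))]; for [k >= n] take
    [M = n s^(-q)] with [s] of order [2^(-k/n)], with error [O(s n^(max(1/2,1/p) - 1/q))].
    The signed first-order terms cancel pointwise when averaging over the rounding, so
    only integrals of nonnegative functions occur. *)

(** * Two-point estimates for powers *)

(** Since [expR (- x) >= 1 - x], one has [expR x <= 1 / (1 - x)], while [(1 - x) * (1 + x + 2 * x ^+
    2) = 1 + x ^+ 2 * (1 - 2 * x) >= 1]. *)
Lemma expR_le_quadratic (R : realType) (x : R) :
  `|x| <= 2^-1 -> expR x <= 1 + x + 2 * x ^+ 2.
Proof.
rewrite ler_norml => /andP[x1 x2].
have h : 1 - x <= expR (- x) by rewrite -[1 - x]/(1 + - x) expR_ge1Dx.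
have := expRxMexpNx_1 x; have e0 := expR_gt0 x; have f0 := expR_gt0 (- x).
nra.
Qed.

Lemma powR_le_id (R : realType) (p x : R) : 1 < p -> 0 <= x <= 1 -> x `^ p <= x.
Proof.
move=> p1 /andP[]; rewrite le_eqVlt => /orP[/eqP <- _|x0 x1].
  by rewrite powR0 // gt_eqF // (lt_trans ltr01).
by apply: ge1r_powR; rewrite ?x0 // ltW.
Qed.

(** For [|x| <= 1 / (2 * p)], [|1 + x| <= expR x] reduces the claim to the quadratic bound on
    [expR (p * x)]; for larger [|x|] every term is [O(|x|^p)]. The boolean factor keeps the
    quadratic term only for [p >= 2]: for [p < 2] and [|x| <= 1], [x^2 <= |x|^p]. *)
Lemma powR_1D_le (R : realType) (p : R) : 1 < p ->
  exists2 K : R, 1 <= K & forall x : R,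
    `|1 + x| `^ p <= 1 + p * x + K * (`|x| `^ p + (2 <= p)%R%:R * x ^+ 2).
Proof.
move=> p1; pose K0 := 2 * p ^+ 2 : R.
pose K1 := (2 * p + 1) `^ p + p * (2 * p) `^ p.
have p0 : 0 < p by lra.
have K1_ge0 : 0 <= K1 by rewrite addr_ge0 ?powR_ge0 // mulr_ge0 ?powR_ge0 // ltW.
exists (K0 + K1 + 1) => [|x].
  by rewrite lerDr addr_ge0 // /K0; nra.
have xp0 := powR_ge0 `|x| p.
have x20 := sqr_ge0 x.
have [xs|xl] := leP `|x| (2 * p)^-1.
  have px : p * `|x| <= 2^-1.
    rewrite mulrC -ler_pdivlMr //; apply: (le_trans xs).
    by rewrite invfM.
  have x1 : `|x| <= 1 by nra.
  have h1 : `|1 + x| <= expR x.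
    rewrite ger0_norm ?expR_ge1Dx //.
    by move: x1; rewrite ler_norml => /andP[]; lra.
  have h2 : `|1 + x| `^ p <= expR (p * x).
    rewrite [p * x]mulrC expRM.
    by apply: ge0_ler_powR; rewrite ?nnegrE ?expR_ge0 ?(ltW p0).
  apply: (le_trans h2).
  have h3 : expR (p * x) <= 1 + p * x + 2 * (p * x) ^+ 2.
    by apply: expR_le_quadratic; rewrite normrM gtr0_norm.
  apply: (le_trans h3); rewrite lerD2l.
  have -> : 2 * (p * x) ^+ 2 = K0 * x ^+ 2 by rewrite /K0; ring.
  have h4 : x ^+ 2 <= `|x| `^ p + (2 <= p)%R%:R * x ^+ 2.
    have [p2|p2] := leP 2 p; first by rewrite mul1r lerDr.
    rewrite mul0r addr0 -real_normK ?num_real // -powR_mulrn //.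
    have [->|x0] := eqVneq x 0.
      by rewrite normr0 !powR0 // gt_eqF.
    by apply: ger_powR; [rewrite normr_gt0 x0|exact: ltW].
  have K00 : 0 <= K0 by rewrite /K0; nra.
  by apply: ler_pM => //; lra.
have x1 : 1 < 2 * p * `|x|.
  by rewrite -ltr_pdivrMl ?mulr1 //; lra.
have h1 : `|1 + x| `^ p <= (2 * p + 1) `^ p * `|x| `^ p.
  rewrite -powRM //; last by lra.
  apply: ge0_ler_powR; rewrite ?nnegrE //; first exact: ltW.
    by rewrite mulr_ge0 //; lra.
  by apply: (le_trans (ler_normD _ _)); rewrite normr1; lra.
have h2 : - (p * x) <= p * (2 * p) `^ p * `|x| `^ p.
  rewrite -mulrA -powRM //; last by lra.
  rewrite -mulrN ler_pM2l //.
  apply: (@le_trans _ _ `|x|); first by rewrite -normrN ler_norm.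
  apply: (@le_trans _ _ (2 * p * `|x|)).
    by rewrite ler_peMl //; lra.
  by apply: le1r_powR; exact: ltW.
have h3 : 0 <= (2 <= p)%R%:R * x ^+ 2 by rewrite mulr_ge0.
have K00 : 0 <= K0 by rewrite /K0; nra.
have h4 : K1 * `|x| `^ p = (2 * p + 1) `^ p * `|x| `^ p + p * (2 * p) `^ p * `|x| `^ p.
  by rewrite /K1 mulrDl.
have h5 : K1 * `|x| `^ p <= (K0 + K1 + 1) * (`|x| `^ p + (2 <= p)%R%:R * x ^+ 2).
  by apply: ler_pM => //; lra.
lra.
Qed.

(** The case [a = 0] of the two-point inequality, from [t^p <= t] at [t = th] and [t = 1 - th]. *)
Lemma two_point_powR_le (R : realType) (p th b : R) : 1 < p -> 0 <= th <= 1 ->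
  (1 - th) * `|th * b| `^ p + th * `|(1 - th) * b| `^ p
    <= 2 * (th * (1 - th)) * `|b| `^ p.
Proof.
move=> p1 /andP[t0 t1].
have s0 : 0 <= 1 - th by rewrite subr_ge0.
rewrite !normrM !powRM // (ger0_norm t0) (ger0_norm s0).
have h1 : th `^ p <= th by apply: powR_le_id; rewrite ?t0.
have h2 : (1 - th) `^ p <= 1 - th.
  by apply: powR_le_id => //; rewrite subr_ge0 t1 gerBl.
have b0 := powR_ge0 `|b| p.
rewrite !mulrA -mulrDl ler_wpM2r //.
by have := ler_wpM2l t0 h2; have := ler_wpM2l s0 h1; lra.
Qed.

(* Averaging removes the linear term, and Young's inequality with parameter [w] splits the
   mixed term [|a|^(p-2) b^2], so that only pure powers of [|a|] and [|b|] are left to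
   integrate; [w] will be the total variance. *)
Lemma two_point_unit_le (R : realType) (p : R) : 1 < p ->
  exists2 K : R, 1 <= K & forall w th b : R, 1 <= w -> 0 <= th <= 1 ->
    (1 - th) * `|1 - th * b| `^ p + th * `|1 + (1 - th) * b| `^ p
    <= 1 + K * (th * (1 - th)) / w
       + K * (th * (1 - th)) * w `^ (Num.max (p / 2) 1 - 1) * `|b| `^ p.
Proof.
move=> p1; have [K K1 HK] := powR_1D_le p1.
exists (3 * K) => [|w th b w1 /andP[t0 t1]]; first lra.
have s0 : 0 <= 1 - th by lra.
have A := ler_wpM2l s0 (HK (- (th * b))).
have B := ler_wpM2l t0 (HK ((1 - th) * b)).
have C := @two_point_powR_le _ p th b p1.
rewrite t0 t1 in C; move/(_ isT) in C.
rewrite normrN in A.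
set e := Num.max _ _ - 1.
have e0 : 0 <= e by rewrite subr_ge0 le_max lexx orbT.
have we : 1 <= w `^ e by rewrite -(powRr0 w); apply: ler_powR.
have b0 := powR_ge0 `|b| p.
pose tau := th * (1 - th); rewrite -/tau in C *.
have tau0 : 0 <= tau by exact: mulr_ge0.
have D : (2 <= p)%R%:R * b ^+ 2 <= w^-1 + w `^ e * `|b| `^ p.
  have w0 : 0 < w by lra.
  have wi : 0 < w^-1 by rewrite invr_gt0.
  have [p2|p2] := leP 2 p; last first.
    by rewrite mul0r addr_ge0 // ?(ltW wi) // mulr_ge0 // powR_ge0.
  rewrite mul1r.
  have ee : e = p / 2 - 1 by rewrite /e max_l //; lra.
  (* If [b^2 w <= 1], the term [1 / w] suffices; otherwise [b^2 w <= (b^2 w)^(p/2)] because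
     [p / 2 >= 1]. *)
  have [h|h] := leP (b ^+ 2 * w) 1.
    apply: (@le_trans _ _ w^-1); first by rewrite -[leRHS]mul1r ler_pdivlMr.
    by rewrite lerDl mulr_ge0 // powR_ge0.
  apply: (@le_trans _ _ (w `^ e * `|b| `^ p)); last by rewrite lerDr ltW.
  rewrite ee powRB; last by rewrite (gt_eqF w0) implybT.
  rewrite powRr1 ?(ltW w0) // mulrAC ler_pdivlMr //.
  have -> : `|b| `^ p = (b ^+ 2) `^ (p / 2).
    rewrite -real_normK ?num_real // -powR_mulrn // -powRrM.
    by congr (_ `^ _); field.
  rewrite -powRM ?sqr_ge0 ?(ltW w0) // [w * _]mulrC.
  by apply: le1r_powR; [exact: ltW|lra].
have E : (1 - th) * `|1 - th * b| `^ p + th * `|1 + (1 - th) * b| `^ p <=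
   1 + K * (2 * tau * `|b| `^ p) + K * (tau * ((2 <= p)%R%:R * b ^+ 2)).
  apply: (le_trans (lerD A B)).
  (* The linear terms cancel, and the squares average to [th * (1 - th) * b^2]. *)
  have -> : forall X Y Z : R,
   (1 - th) * (1 + p * - (th * b) + K * (X + Z * (- (th * b)) ^+ 2)) +
   th * (1 + p * ((1 - th) * b) + K * (Y + Z * ((1 - th) * b) ^+ 2)) =
   1 + K * ((1 - th) * X + th * Y) + K * (tau * (Z * b ^+ 2)).
    by move=> X Y Z; rewrite /tau; ring.
  by rewrite lerD2r lerD2l ler_wpM2l //; lra.
apply: (le_trans E); clear A B E; clearbody tau.
have F := ler_wpM2l tau0 D.
have G : tau * `|b| `^ p <= tau * (w `^ e * `|b| `^ p).
  by rewrite ler_wpM2l // ler_peMl.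
have G0 : 0 <= tau * `|b| `^ p by exact: mulr_ge0.
have wi : 0 <= tau / w by rewrite divr_ge0 //; lra.
rewrite -!mulrA -!addrA lerD2l; rewrite mulrDr in F.
have K0 : 0 <= K by lra.
have := ler_wpM2l K0 F; have := ler_wpM2l K0 G.
have := mulr_ge0 K0 wi; have := mulr_ge0 K0 G0.
by lra.
Qed.

(** By homogeneity: apply the case [a = 1] to [b / a] and multiply by [|a|^p]. *)
Lemma two_point_le (R : realType) (p : R) : 1 < p ->
  exists2 K : R, 1 <= K & forall w th a b : R, 1 <= w -> 0 <= th <= 1 ->
    (1 - th) * `|a - th * b| `^ p + th * `|a + (1 - th) * b| `^ p
    <= (1 + K * (th * (1 - th)) / w) * `|a| `^ p
       + K * (th * (1 - th)) * w `^ (Num.max (p / 2) 1 - 1) * `|b| `^ p.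
Proof.
move=> p1; have [K K1 HK] := two_point_unit_le p1.
exists (2 * K) => [|w th a b w1 t01]; first lra.
have /andP[t0 t1] := t01.
have s0 : 0 <= 1 - th by lra.
set e := Num.max _ _ - 1.
have e0 : 0 <= e by rewrite subr_ge0 le_max lexx orbT.
have we : 1 <= w `^ e by rewrite -(powRr0 w); apply: ler_powR.
pose tau := th * (1 - th); rewrite -/tau.
have tau0 : 0 <= tau by exact: mulr_ge0.
have K0 : 0 <= K by lra.
have [->|a0] := eqVneq a 0.
  rewrite sub0r add0r normrN normr0 powR0 ?mulr0 ?add0r; last by rewrite gt_eqF; lra.
  apply: (le_trans (two_point_powR_le b p1 t01)).
  rewrite ler_wpM2r ?powR_ge0 // -/tau -[leLHS]mulr1; apply: ler_pM => //; first lra.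
  by rewrite ler_wpM2r //; lra.
have H := HK w th (b / a) w1 t01.
rewrite -/e -/tau in H; clearbody tau.
have ap := powR_ge0 `|a| p.
have sc s : `|a + s| `^ p = `|1 + s / a| `^ p * `|a| `^ p.
  by rewrite -powRM // -normrM mulrDl mul1r divfK.
rewrite !sc mulNr -!mulrA.
have sb : `|b| `^ p = `|b / a| `^ p * `|a| `^ p.
  by rewrite -powRM // -normrM divfK.
rewrite sb.
have := ler_wpM2r ap H.
have wi : 0 <= tau / w by rewrite divr_ge0 //; lra.
have G1 := mulr_ge0 (mulr_ge0 K0 wi) ap.
have Kw : 0 <= K * (tau * w `^ e) by rewrite !mulr_ge0 ?powR_ge0.
have G2 := mulr_ge0 (mulr_ge0 Kw (powR_ge0 `|b / a| p)) ap.
move: G1 G2; rewrite -!mulrA !mulrDl -!mulrA mul1r.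
by lra.
Qed.

(** * The seminorm of L_p *)

Section Lp_norm_theory.
Context {d : measure_display} {T : measurableType d} {R : realType}.
Variables (mu : {measure set T -> \bar R}) (p : R) (p1 : 1 < p).
Implicit Types f g : Lp mu p1.

Lemma Lp_norm_ge0 f : 0 <= Lp_norm f.
Proof. exact/fine_ge0/Lnorm_ge0. Qed.

Lemma Lp_normD f g : Lp_norm (f + g) <= Lp_norm f + Lp_norm g.
Proof. exact: ler_LnormD. Qed.

Lemma Lp_normZ a f : Lp_norm (a *: f) = `|a| * Lp_norm f.
Proof.
by apply: EFin_inj; rewrite EFinM /Lp_norm !finite_norm_fine -LnormZ.
Qed.

Lemma Lp_norm_powE f :
  (Lp_norm f `^ p)%:E = (\int[mu]_x (`|f x| `^ p)%:E)%E.
Proof.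
rewrite -poweR_EFin /Lp_norm finite_norm_fine powR_Lnorm //.
by rewrite gt_eqF // (lt_trans ltr01).
Qed.

Lemma measurable_powR_norm f : measurable_fun setT (fun x => `|f x| `^ p).
Proof.
apply: (@measurableT_comp _ _ _ _ _ _ (@powR R ^~ p)) => //.
exact: measurableT_comp.
Qed.

End Lp_norm_theory.

(** The pointwise inequality is integrated, so [K] is the same for all measure spaces. *)
Lemma Lp_norm_two_point (R : realType) (p : R) (p1 : 1 < p) :
  exists2 K : R, 1 <= K & forall (d : measure_display) (T : measurableType d)
      (mu : {measure set T -> \bar R}) (w th : R) (S g : Lp mu p1),
    1 <= w -> 0 <= th <= 1 ->
    (1 - th) * Lp_norm (S - th *: g) `^ p + th * Lp_norm (S + (1 - th) *: g) `^ p
    <= (1 + K * (th * (1 - th)) / w) * Lp_norm S `^ p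
       + K * (th * (1 - th)) * w `^ (Num.max (p / 2) 1 - 1) * Lp_norm g `^ p.
Proof.
have [K K1 HK] := two_point_le p1.
exists K => // d T mu w th S g w1 t01.
have /andP[t0 t1] := t01.
have t1' : 0 <= 1 - th by rewrite subr_ge0.
have c0 : 0 <= th * (1 - th) by exact: mulr_ge0.
have K0 : 0 <= K by lra.
have mp a (h : Lp mu p1) : measurable_fun setT (fun x => a * `|h x| `^ p).
  by apply: measurable_funM; [exact: measurable_cst|exact: measurable_powR_norm].
have combE (a b : R) (u v : Lp mu p1) : 0 <= a -> 0 <= b ->
    (a * Lp_norm u `^ p + b * Lp_norm v `^ p)%:E =
    (\int[mu]_x (a * `|u x| `^ p + b * `|v x| `^ p)%:E)%E.
  move=> a0 b0.
  have pos (h : Lp mu p1) x : (0 <= (`|h x| `^ p)%:E)%E by rewrite lee_fin powR_ge0.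
  under eq_integral do rewrite EFinD !EFinM.
  rewrite ge0_integralD //; first last.
  - by apply/measurable_EFinP; exact: mp.
  - by move=> x _; rewrite mule_ge0.
  - by apply/measurable_EFinP; exact: mp.
  - by move=> x _; rewrite mule_ge0.
  have mpe (h : Lp mu p1) : measurable_fun setT (fun x => (`|h x| `^ p)%:E : \bar R).
    by apply/measurable_EFinP; exact: measurable_powR_norm.
  by rewrite !ge0_integralZl_EFin // EFinD !EFinM !Lp_norm_powE.
rewrite -lee_fin !combE //; first last.
- by rewrite !mulr_ge0 // powR_ge0.
- by rewrite addr_ge0 // divr_ge0 ?mulr_ge0 //; lra.
apply: ge0_le_integral => //.
- by move=> x _; rewrite lee_fin addr_ge0 // mulr_ge0 // powR_ge0.
- by apply/measurable_EFinP; apply: measurable_funD; exact: mp.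
- by apply/measurable_EFinP; apply: measurable_funD; exact: mp.
- by move=> x _; rewrite lee_fin; exact: (HK w th (S x) (g x)).
Qed.

(** * Randomized rounding *)

Section floor_rounding.
Context {R : realType}.
Implicit Types x y q : R.

(** The probability of rounding [y] up when the rounding is unbiased. *)
Definition frac_part y : R := y - (Num.floor y)%:~R.

(* The variance of the mean-zero rounding of [y] to one of the two adjacent integers. *)
Definition rounding_var y : R := frac_part y * (1 - frac_part y).

Lemma frac_part_itv y : 0 <= frac_part y <= 1.
Proof.
rewrite /frac_part subr_ge0 floor_le_tmp /= lerBlDl.
by rewrite -intrD1 ltW // floorD1_gt.
Qed.

Lemma rounding_var_ge0 y : 0 <= rounding_var y.
Proof. by have /andP[? ?] := frac_part_itv y; rewrite mulr_ge0 // subr_ge0. Qed.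

Lemma rounding_var_le1 y : rounding_var y <= 1.
Proof. by have /andP[? ?] := frac_part_itv y; rewrite mulr_ile1 // ?subr_ge0 ?gerBl. Qed.

Lemma floor_norm_lt1 y : `|y| < 1 ->
  Num.floor y = 0 /\ 0 <= y \/ Num.floor y = -1 /\ y < 0.
Proof.
rewrite ltr_norml => /andP[y1 y2]; have [y0|y0] := leP 0 y; [left|right]; split => //.
  by apply: floor_def; rewrite mulr0z y0.
by apply: floor_def; rewrite addrC subrr y0 mulrNz ltW.
Qed.

Lemma norm_le_powR y q : 0 < q <= 1 -> `|y| < 1 -> `|y| <= `|y| `^ q.
Proof.
move=> /andP[q0 q1] y1; have [->|y0] := eqVneq y 0; first by rewrite normr0 powR_ge0.
by apply: ger1_powR => //; rewrite normr_gt0 y0 ltW.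
Qed.

(** For [|y| >= 1] the variance is at most [1 <= |y|^q]; for [|y| < 1] it is at most [|y| <= |y|^q].
    This bounds the total variance by [M]. *)
Lemma rounding_var_le_powR y q : 0 < q <= 1 -> rounding_var y <= `|y| `^ q.
Proof.
move=> q01; have /andP[q0 q1] := q01.
have [y1|y1] := leP 1 `|y|.
  apply: (le_trans (rounding_var_le1 y)).
  apply: (@le_trans _ _ (1 `^ q)); first by rewrite powR1.
  by rewrite ge0_ler_powR ?nnegrE // ltW.
apply: le_trans (norm_le_powR q01 y1).
have /andP[t0 t1] := frac_part_itv y; move: t0 t1.
rewrite /rounding_var /frac_part.
have [[-> y0]|[-> y0]] := floor_norm_lt1 y1.
  by rewrite ger0_norm // mulr0z subr0; nra.
by rewrite ltr0_norm // mulrNz mulr1z; nra.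
Qed.

(** For [|y| >= 1] both neighbours have modulus at most [2 |y|], and [2^q <= 2]. For [|y| < 1] one
    neighbour is [0] and the other, of modulus [1], has probability [|y| <= |y|^q]. *)
Lemma rounding_powR_le y q : 0 < q <= 1 ->
  (1 - frac_part y) * `|(Num.floor y)%:~R : R| `^ q
    + frac_part y * `|(Num.floor y + 1)%:~R : R| `^ q <= 2 * `|y| `^ q.
Proof.
move=> q01; have /andP[q0 q1] := q01.
have /andP[t0 t1] := frac_part_itv y.
have yq := powR_ge0 `|y| q.
have [y1|y1] := leP 1 `|y|.
  have two : (2 : R) `^ q <= 2 by apply: ler1_powR => //; lra.
  have bnd x : `|x| <= 2 * `|y| -> `|x| `^ q <= 2 * `|y| `^ q.
    move=> xy; apply: (@le_trans _ _ ((2 * `|y|) `^ q)).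
      by rewrite ge0_ler_powR ?nnegrE ?(ltW q0) // mulr_ge0.
    by rewrite powRM // ler_wpM2r.
  have b1 : `|(Num.floor y)%:~R : R| <= 2 * `|y|.
    have -> : (Num.floor y)%:~R = y - frac_part y by rewrite /frac_part; ring.
    by apply: (le_trans (ler_normB _ _)); rewrite (ger0_norm t0); lra.
  have b2 : `|(Num.floor y + 1)%:~R : R| <= 2 * `|y|.
    have -> : (Num.floor y + 1)%:~R = y + (1 - frac_part y).
      by rewrite intrD /frac_part; ring.
    by apply: (le_trans (ler_normD _ _)); rewrite [X in _ + X]ger0_norm; lra.
  have := bnd _ b1; have := bnd _ b2.
  move: (_ `^ q) (_ `^ q) (2 * _) => A B C AC BC.
  have s0 : 0 <= 1 - frac_part y by rewrite subr_ge0.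
  have := ler_wpM2l t0 AC; have := ler_wpM2l s0 BC; lra.
have h := norm_le_powR q01 y1; move: t0 t1.
rewrite /frac_part; have [[-> y0]|[-> y0]] := floor_norm_lt1 y1.
  rewrite mulr0z normr0 powR0 ?gt_eqF // add0r normr1 powR1.
  by move: h; rewrite ger0_norm //; lra.
rewrite addNr mulr0z normr0 powR0 ?gt_eqF // mulrNz normrN normr1 powR1.
by move: h; rewrite ltr0_norm //; lra.
Qed.

End floor_rounding.

Section greedy_rounding.
Context {R : realType} {X : lmodType R}.
Variables (F : X -> R) (q K w D : R).
Hypotheses (q01 : 0 < q <= 1) (F0 : forall x, 0 <= F x) (K0 : 0 <= K)
  (w0 : 0 < w) (D0 : 0 <= D).

(* Method of conditional expectations: each coefficient is rounded to whichever
   adjacent integer does not increase the expected potential. *)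
Lemma greedy_rounding (a b : R) (n : nat) (g : 'I_n -> X) (y : 'I_n -> R) (S : X) :
  0 <= a -> 0 <= b ->
  (forall i (th : R) x, 0 <= th <= 1 ->
    (1 - th) * F (x - th *: g i) + th * F (x + (1 - th) *: g i)
    <= (1 + K * (th * (1 - th)) / w) * F x + D * (th * (1 - th))) ->
  exists z : 'I_n -> int,
    a * F (S + \sum_(j < n) ((z j)%:~R - y j) *: g j)
      + b * \sum_(j < n) `|(z j)%:~R : R| `^ q
    <= expR (K / w * \sum_(j < n) rounding_var (y j)) *
       (a * F S + \sum_(j < n) (a * D * rounding_var (y j) + b * (2 * `|y j| `^ q))).
Proof.
move=> a0 b0; have cost0 x : 0 <= a * D * rounding_var x + b * (2 * `|x| `^ q).
  by rewrite addr_ge0 // mulr_ge0 ?rounding_var_ge0 ?mulr_ge0 ?powR_ge0.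
(* [S] is generalized because the error made on the first coefficient becomes part of the starting
   point for the others. *)
elim: n g y S => [|n IH] g y S HF.
  by exists (fun=> 0); rewrite !big_ord0 mulr0 !addr0 mulr0 expR0 mul1r.
pose th := frac_part (y ord0); pose tau := rounding_var (y ord0).
have /andP[t0 t1] := frac_part_itv (y ord0); rewrite -/th in t0 t1.
pose E := expR (K / w * tau).
have Ktw : 0 <= K / w * tau by rewrite mulr_ge0 ?rounding_var_ge0 // divr_ge0 // ltW.
have E1 : 1 <= E by rewrite -expR0 ler_expR.
pose c0 := a * D * tau + b * (2 * `|y ord0| `^ q).
have c00 : 0 <= c0 by exact: cost0.
have [z0 Hz0] : exists z0 : int,
    a * F (S + (z0%:~R - y ord0) *: g ord0) + b * `|z0%:~R : R| `^ q <= E * (a * F S + c0).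
  pose fl := Num.floor (y ord0).
  have H1 := HF ord0 th S (frac_part_itv _).
  have H2 := rounding_powR_le (y ord0) q01.
  rewrite -/th -/fl in H2.
  have e1 : (fl%:~R - y ord0) *: g ord0 = - (th *: g ord0).
    by rewrite -scaleNr /th /frac_part opprB.
  have e2 : ((fl + 1)%:~R - y ord0) *: g ord0 = (1 - th) *: g ord0.
    by congr (_ *: _); rewrite intrD /th /frac_part -/fl; ring.
  (* [A] and [B] are the potentials after rounding down and up; their mean with weights [1 - th] and
     [th] obeys the bound, so one of them does. *)
  pose A := a * F (S - th *: g ord0) + b * `|fl%:~R : R| `^ q.
  pose B := a * F (S + (1 - th) *: g ord0) + b * `|(fl + 1)%:~R : R| `^ q.
  have avg : (1 - th) * A + th * B <= E * (a * F S + c0).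
    apply: (@le_trans _ _ ((1 + K / w * tau) * (a * F S) + c0)).
      rewrite /A /B /c0 /tau /rounding_var -/th.
      have := ler_wpM2l a0 H1; have := ler_wpM2l b0 H2; lra.
    rewrite mulrDr lerD //; last by rewrite ler_peMl.
    by rewrite ler_wpM2r ?mulr_ge0 // /E expR_ge1Dx.
  have [HA|HA] := leP A (E * (a * F S + c0)).
    by exists fl; rewrite e1.
  exists (fl + 1); rewrite e2 -/B.
  have [//|HB] := leP B (E * (a * F S + c0)).
  move: avg HA HB; move: (E * _) A B => C A B avg HA HB; exfalso.
  have s0 : 0 <= 1 - th by rewrite subr_ge0.
  have h1 := ler_wpM2l s0 (ltW HA); have h2 := ler_wpM2l t0 (ltW HB).
  have [t2|t2] := leP th (1 / 2).
    have : 0 < (1 - th) * (A - C) by rewrite mulr_gt0 //; lra.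
    lra.
  have : 0 < th * (B - C) by rewrite mulr_gt0 //; lra.
  lra.
have HF' (i : 'I_n) th' x := HF (lift ord0 i) th' x.
have [z Hz] := IH (g \o lift ord0) (y \o lift ord0) (S + (z0%:~R - y ord0) *: g ord0) HF'.
exists (fun j => if unlift ord0 j is Some i then z i else z0).
rewrite !big_ord_recl unlift_none.
under eq_bigr do rewrite liftK.
under [X in _ + _ * (_ + X) <= _]eq_bigr do rewrite liftK.
move: Hz; rewrite /= !addrA.
set S1 := \sum_(i < n) _; set S2 := \sum_(i < n) _; set S3 := \sum_(i < n) _.
set S4 := \sum_(i < n) _.
rewrite -/tau [K / w * (_ + _)]mulrDr expRD -/E -[a * F S + _ + _]addrA -/c0 => Hz.
have S30 : 0 <= K / w * S3.
  rewrite mulr_ge0 ?divr_ge0 ?(ltW w0) // sumr_ge0 // => i _.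
  exact: rounding_var_ge0.
have S40 : 0 <= S4 by rewrite sumr_ge0.
have E'1 : 1 <= expR (K / w * S3) by rewrite -expR0 ler_expR.
have Z0 : 0 <= b * `|z0%:~R : R| `^ q by rewrite mulr_ge0 // powR_ge0.
move: Hz Hz0 E'1 Z0; set E' := expR (K / w * S3).
rewrite [b * (_ + S2)]mulrDr.
move: (a * F (S + _ *: _)) (b * `|_| `^ q) => F2 Z Hz Hz0 E'1 Z0.
have U0 : 0 <= a * F S + c0 by rewrite addr_ge0 // mulr_ge0.
move: U0 Hz0; move: (a * F S + c0) => U U0 Hz0.
move: (a * F _) (b * S2) Hz => V W Hz.
(* The cost [Z] of the first integer is not in the induction hypothesis; it enters the bracket
   because [E' >= 1]. *)
apply: (@le_trans _ _ (E' * (F2 + Z + S4))).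
  have : Z <= E' * Z by rewrite ler_peMl.
  by rewrite !mulrDr in Hz *; lra.
rewrite [E * E']mulrC -mulrA ler_pM2l ?expR_gt0 // mulrDr lerD //.
by rewrite ler_peMl.
Qed.
End greedy_rounding.

(** Norm and cost are controlled together by the potential [F / (D * w) + cost / (2 * M)]. It starts
    at [0], and the greedy choice keeps it at most [2 * expR K], hence each of its two nonnegative
    terms too. *)
Lemma Lp_rounding (R : realType) (p : R) (p1 : 1 < p) :
  exists2 A : R, 1 <= A & forall (d : measure_display) (T : measurableType d)
      (mu : {measure set T -> \bar R}) (n : nat) (g : 'I_n -> Lp mu p1)
      (q M w : R) (y : 'I_n -> R),
    normalized_system (@Lp_norm _ _ _ mu p p1) g -> 0 < q <= 1 -> 0 < M -> 1 <= w ->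
    \sum_(j < n) `|y j| `^ q <= M -> \sum_(j < n) rounding_var (y j) <= w ->
    exists2 z : 'I_n -> int,
      \sum_(j < n) `|(z j)%:~R : R| `^ q <= A * M &
      Lp_norm (\sum_(j < n) ((z j)%:~R - y j) *: g j) <= A * w `^ Num.max 2^-1 p^-1.
Proof.
have [K K1 HK] := Lp_norm_two_point p1.
have p0 : 0 < p by lra.
have eK0 := expR_gt0 K.
have eK1 : 1 <= expR K by rewrite -expR0 ler_expR; lra.
pose A0 := 2 * expR K * K.
have A0_gt0 : 0 < A0 by rewrite /A0 !mulr_gt0 //; lra.
have A1_ge0 := powR_ge0 A0 p^-1.
(* The first summand serves the cost, the p-th root of [A0] serves the norm. *)
exists (4 * expR K + A0 `^ p^-1); first by lra.
move=> d T mu n g q M w y gN q01 M0 w1 yM yw.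
have w0 : 0 < w by lra.
pose D := K * w `^ (Num.max (p / 2) 1 - 1).
have D0 : 0 < D by rewrite mulr_gt0 ?powR_gt0 //; lra.
have K0 : 0 <= K by lra.
pose F (f : Lp mu p1) := Lp_norm f `^ p.
have F0 f : 0 <= F f by exact: powR_ge0.
have a0 : 0 <= (D * w)^-1 by rewrite invr_ge0 mulr_ge0 // ltW.
have b0 : 0 <= (2 * M)^-1 by rewrite invr_ge0 mulr_ge0 // ltW.
have step (i : 'I_n) th x : 0 <= th <= 1 ->
    (1 - th) * F (x - th *: g i) + th * F (x + (1 - th) *: g i)
    <= (1 + K * (th * (1 - th)) / w) * F x + D * (th * (1 - th)).
  move=> t01; apply: (le_trans (HK _ _ _ w th x (g i) w1 t01)).
  rewrite gN powR1 mulr1 lerD2l /D; set e := w `^ _.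
  by have -> : K * (th * (1 - th)) * e = K * e * (th * (1 - th)) by ring.
have [z Hz] := greedy_rounding q01 F0 K0 w0 (ltW D0) y 0 a0 b0 step.
have FO : F 0 = 0.
  by rewrite /F -(scale0r 0) Lp_normZ normr0 mul0r powR0 // gt_eqF.
rewrite FO mulr0 !add0r in Hz.
have bound : expR (K / w * \sum_(j < n) rounding_var (y j)) *
     (\sum_(j < n) ((D * w)^-1 * D * rounding_var (y j) + (2 * M)^-1 * (2 * `|y j| `^ q)))
   <= expR K * 2.
  apply: ler_pM.
  - exact: expR_ge0.
  - apply: sumr_ge0 => j _; apply: addr_ge0; apply: mulr_ge0 => //.
    + by rewrite mulr_ge0 // ltW.
    + exact: rounding_var_ge0.
  - by rewrite ler_expR mulrAC ler_pdivrMr // ler_wpM2l.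
  rewrite big_split /= -!mulr_sumr invfM [D^-1 * _]mulrC mulfVK ?gt_eqF //.
  apply: (@le_trans _ _ (w^-1 * w + (2 * M)^-1 * (2 * M))).
    by apply: lerD; apply: ler_wpM2l => //; rewrite ?invr_ge0 ?ler_pM2l // ltW.
  by rewrite !mulVf ?gt_eqF //; lra.
have {Hz bound}Hz := le_trans Hz bound.
set S := \sum_(j < n) _ *: _ in Hz *; set Z := \sum_(j < n) _ in Hz *.
have Z0 : 0 <= Z by rewrite sumr_ge0 // => j _; exact: powR_ge0.
exists z.
  rewrite -/Z.
  have : (2 * M)^-1 * Z <= expR K * 2.
    by apply: le_trans Hz; rewrite lerDr mulr_ge0.
  rewrite ler_pdivrMl ?mulr_gt0 // => h; apply: (le_trans h).
  by rewrite mulrDl; have := mulr_ge0 A1_ge0 (ltW M0); lra.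
(* [D * w] is [K] times [w] to the power [max(p/2, 1)]; the p-th root taken below turns this
   exponent into [max(1/2, 1/p)]. *)
have HF : F S <= A0 * w `^ Num.max (p / 2) 1.
  have : (D * w)^-1 * F S <= expR K * 2.
    by apply: le_trans Hz; rewrite lerDl mulr_ge0.
  rewrite ler_pdivrMl; last exact: mulr_gt0.
  move=> h; apply: (le_trans h).
  rewrite /A0 -[X in w `^ X](subrK 1) powRD; last by rewrite (gt_eqF w0) implybT.
  rewrite powRr1 ?(ltW w0) // /D; set e := w `^ _.
  by have -> : K * e * w * (expR K * 2) = 2 * expR K * K * (e * w) by ring.
have -> : Lp_norm S = F S `^ p^-1.
  by rewrite /F -powRrM mulfV ?gt_eqF // powRr1 // Lp_norm_ge0.
have maxE : Num.max (p / 2) 1 * p^-1 = Num.max 2^-1 p^-1.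
  by rewrite maxr_pMl ?invr_ge0 ?(ltW p0) // mulrAC mulfV ?gt_eqF // !mul1r.
apply: (@le_trans _ _ ((A0 * w `^ Num.max (p / 2) 1) `^ p^-1)).
  by rewrite ge0_ler_powR ?nnegrE ?invr_ge0 ?(ltW p0) // mulr_ge0 ?powR_ge0 // ltW.
rewrite powRM ?powR_ge0 ?(ltW A0_gt0) // -powRrM maxE ler_wpM2r ?powR_ge0 //.
by lra.
Qed.

(** * Counting lattice points *)

Section lattice_points.
Context {R : realType}.
Implicit Types (u q s lam : R).

(** For [u <= 1], [1 + u <= expR u] and [u <= u^q]. For [u > 1], writing [u = (u^q)^(1/q)] gives
    [u <= expR ((u^q - 1) / q)], and [1 + u <= 2 * u <= expR (1 / q) * u]. *)
Lemma add1_le_expR_powR u q : 0 <= u -> 0 < q <= 1 -> 1 + u <= expR (q^-1 * u `^ q).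
Proof.
move=> u0 /andP[q0 q1].
have qi1 : 1 <= q^-1 by rewrite invf_ge1.
have uq0 := powR_ge0 u q.
have [u1|u1] := leP u 1.
  apply: (le_trans (expR_ge1Dx u)); rewrite ler_expR.
  apply: (@le_trans _ _ (u `^ q)); last by rewrite ler_peMl.
  have := @norm_le_powR _ u q; rewrite ger0_norm // q0 q1 => h.
  move: u1; rewrite le_eqVlt => /orP[/eqP ->|/h]; first by rewrite powR1.
  exact.
have h : u <= expR (q^-1 * (u `^ q - 1)).
  have {1}-> : u = (u `^ q) `^ q^-1 by rewrite -powRrM mulfV ?gt_eqF // powRr1.
  rewrite mulrC expRM ge0_ler_powR ?nnegrE ?expR_ge0 ?invr_ge0 ?(ltW q0) //.
  by have := expR_ge1Dx (u `^ q - 1); rewrite addrC subrK.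
have e2 : 2 <= expR q^-1 by have := expR_ge1Dx q^-1; lra.
have -> : q^-1 * u `^ q = q^-1 * (u `^ q - 1) + q^-1 by ring.
by rewrite expRD; have := expR_gt0 q^-1; nra.
Qed.

(** Telescoping: with [a = 1 + s * N], [1 / (a + s)^2 <= 1 / (a * (a + s)) = (1 / a - 1 / (a + s)) /
    s]. *)
Lemma sum_inv_sqr_le s (N : nat) : 0 < s ->
  \sum_(i < N) ((1 + s * i.+1%:R) ^+ 2)^-1 <= s^-1.
Proof.
move=> s0.
have pos (i : nat) : 0 < 1 + s * i%:R by have := mulr_ge0 (ltW s0) (ler0n R i); lra.
suff : \sum_(i < N) ((1 + s * i.+1%:R) ^+ 2)^-1 <= (1 - (1 + s * N%:R)^-1) / s.
  move/le_trans; apply; rewrite -[leRHS]mul1r ler_pM2r ?invr_gt0 //.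
  by rewrite gerBl invr_ge0 ltW.
elim: N => [|N IH]; first by rewrite big_ord0 mulr0 addr0 invr1 subrr mul0r.
rewrite big_ord_recr /=; apply: (le_trans (lerD IH (lexx _))).
rewrite -lerBrDl -mulrBl; have := pos N.
have -> : 1 + s * N.+1%:R = 1 + s * N%:R + s by rewrite -natr1; ring.
move: (1 + s * N%:R) => a a0; have b0 : 0 < a + s by lra.
have -> : (1 - (a + s)^-1 - (1 - a^-1)) / s = (a + s)^-1 * a^-1.
  by field; rewrite !gt_eqF.
by rewrite expr2 invfM ler_pM2l ?invr_gt0 // lef_pV2 ?posrE //; lra.
Qed.

(* Products of these weights are at least [expR (- c * \sum_j |z_j|^q)] while their sum over
   [Z^n] factorizes, which bounds the number of [z] with [\sum_j |z_j|^q <= B]. *)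
Definition lattice_weight lam s (z : int) : R :=
  if z == 0 then 1 else lam * ((1 + s * `|z%:~R|) ^+ 2)^-1.

(** For [z <> 0], [|z|^q >= 1] gives [lam >= expR (ln lam * |z|^q)], and the rational factor is
    bounded below by [add1_le_expR_powR] squared. At [z = 0] both sides are [1]. *)
Lemma lattice_weight_ge lam s q (z : int) : 0 < lam <= 1 -> 0 < s -> 0 < q <= 1 ->
  expR (- ((2 / q * s `^ q - ln lam) * `|z%:~R| `^ q)) <= lattice_weight lam s z.
Proof.
move=> /andP[l0 l1] s0 /andP[q0 q1]; rewrite /lattice_weight.
have [->|z0] := eqVneq z 0.
  by rewrite mulr0z normr0 powR0 ?gt_eqF // mulr0 oppr0 expR0.
have z1 : 1 <= `|z%:~R : R| by rewrite -intr_norm ler1z -gtz0_ge1 normr_gt0.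
have zq1 : 1 <= `|z%:~R : R| `^ q.
  by rewrite -[leLHS](powRr0 `|z%:~R : R|) ler_powR // ltW.
set x := `|z%:~R : R| in z1 zq1 *.
have -> : - ((2 / q * s `^ q - ln lam) * x `^ q) =
    ln lam * x `^ q + - (2 * (q^-1 * (s * x) `^ q)).
  by rewrite powRM ?(ltW s0) ?normr_ge0 //; ring.
rewrite expRD; apply: ler_pM; rewrite ?expR_ge0 //.
  rewrite -[leRHS]lnK ?posrE // ler_expR.
  by have := ln_le0 l1; nra.
rewrite expRN lef_pV2 ?posrE ?expR_gt0 //; last first.
  by rewrite exprn_gt0 //; nra.
rewrite [2 * _]mulrC expRM_natr ler_sqr ?nnegrE ?expR_ge0 //.
  by rewrite add1_le_expR_powR ?q0 // mulr_ge0 ?(ltW s0) ?normr_ge0.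
by nra.
Qed.

(** A finite type enumerating the integers of [[-N, N]]: [0..N] on the left, [-1..-N] on the
    right. *)
Definition int_of_sum (N : nat) (i : 'I_N.+1 + 'I_N) : int :=
  match i with inl i => Posz i | inr i => Negz i end.

Lemma sum_lattice_weight_le lam s (N : nat) : 0 < lam -> 0 < s ->
  \sum_(i : 'I_N.+1 + 'I_N) lattice_weight lam s (int_of_sum i) <= 1 + 2 * lam / s.
Proof.
move=> l0 s0; rewrite big_sumType /= big_ord_recl /=.
have h (f : 'I_N -> int) : (forall i, f i != 0 /\ `|(f i)%:~R : R| = i.+1%:R) ->
    \sum_(i < N) lattice_weight lam s (f i) <= lam / s.
  move=> Hf; under eq_bigr => i _.
    by rewrite /lattice_weight (negbTE (Hf i).1) (Hf i).2; over.
  by rewrite -mulr_sumr ler_wpM2l ?(ltW l0) // sum_inv_sqr_le.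
rewrite {1}/lattice_weight /= -addrA lerD2l.
have -> : 2 * lam / s = lam / s + lam / s by ring.
by apply: lerD; apply: h => i; rewrite ?NegzE ?rmorphN /= ?normrN ?normr_nat.
Qed.

(** Both parameters stay free: a small [lam] suits points with few nonzero coordinates, a small [s]
    suits large coordinates. *)
Lemma lattice_count (n : nat) (lam s q B : R) :
  0 < lam <= 1 -> 0 < s -> 0 < q <= 1 -> 0 <= B ->
  exists2 Z : seq {ffun 'I_n -> int},
    (size Z)%:R <= expR ((2 / q * s `^ q - ln lam) * B) * (1 + 2 * lam / s) ^+ n &
    forall z : 'I_n -> int, \sum_(j < n) `|(z j)%:~R : R| `^ q <= B -> [ffun j => z j] \in Z.
Proof.
move=> l01 s0 q01 B0; have /andP[q0 q1] := q01; have /andP[l0 l1] := l01.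
pose c := 2 / q * s `^ q - ln lam.
have c0 : 0 <= c.
  rewrite subr_ge0; apply: (le_trans (ln_le0 l1)); rewrite mulr_ge0 ?powR_ge0 //.
  by rewrite divr_ge0 // ltW.
(* Each [|z_j|] is at most [B^(1/q)], so the box [[-N, N]^n] contains all points to be counted. *)
pose N := (Num.truncn (B `^ q^-1)).+1.
pose val (f : {ffun 'I_n -> 'I_N.+1 + 'I_N}) := [ffun j => int_of_sum (f j)].
pose P := [set f : {ffun 'I_n -> 'I_N.+1 + 'I_N} |
  \sum_(j < n) `|(val f j)%:~R : R| `^ q <= B]%SET.
exists (map val (enum P)).
  rewrite size_map -cardE.
  have H : #|P|%:R * expR (- (c * B)) <= (1 + 2 * lam / s) ^+ n.
    apply: (@le_trans _ _ (\prod_(j < n) \sum_(i : 'I_N.+1 + 'I_N)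
        lattice_weight lam s (int_of_sum i))).
      rewrite bigA_distr_bigA /= mulr_natl -sumr_const.
      rewrite [leRHS](bigID (mem P)) /= -[leLHS]addr0; apply: lerD; last first.
        apply: sumr_ge0 => f _; apply: prodr_ge0 => j _.
        apply: le_trans (lattice_weight_ge _ l01 s0 q01); exact: expR_ge0.
      apply: ler_sum => f; rewrite inE => Hf.
      apply: (@le_trans _ _ (\prod_(j < n) expR (- (c * `|(val f j)%:~R : R| `^ q)))).
        rewrite -expR_sum ler_expR sumrN lerN2 -mulr_sumr.
        by rewrite ler_wpM2l.
      apply: ler_prod => j _; rewrite expR_ge0 /= ffunE.
      exact: lattice_weight_ge.
    rewrite prodr_const card_ord; apply: lerXn2r; rewrite ?nnegrE.
    - apply: sumr_ge0 => i _.
      apply: le_trans (lattice_weight_ge _ l01 s0 q01); exact: expR_ge0.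
    - by rewrite addr_ge0 // divr_ge0 ?(ltW s0) // mulr_ge0 // ltW.
    - exact: sum_lattice_weight_le.
  by rewrite -ler_pdivrMl ?expR_gt0 // -expRN mulrC.
move=> z Hz.
have zN j : (`|z j| < N)%N.
  have : `|(z j)%:~R : R| `^ q <= B.
    apply: le_trans Hz; rewrite (bigD1 j) //= lerDl; apply: sumr_ge0 => i _; exact: powR_ge0.
  move=> h; have {}h : `|(z j)%:~R : R| <= B `^ q^-1.
    have -> : `|(z j)%:~R : R| = (`|(z j)%:~R : R| `^ q) `^ q^-1.
      by rewrite -powRrM mulfV ?gt_eqF // powRr1.
    by rewrite ge0_ler_powR ?nnegrE ?invr_ge0 ?powR_ge0 ?(ltW q0).
  rewrite /N ltnS truncn_ge_nat ?powR_ge0 //.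
  by rewrite -intr_norm -abszE in h.
have /choice[f Hf] : forall j, exists i : 'I_N.+1 + 'I_N, int_of_sum i = z j.
  move=> j; have := zN j; case: (z j) => m /= mN.
    by exists (inl (Ordinal (ltnW mN : (m < N.+1)%N))).
  by exists (inr (Ordinal (ltnW mN : (m < N)%N))).
have -> : [ffun j => z j] = val [ffun j => f j].
  by apply/ffunP => j; rewrite !ffunE Hf.
apply: map_f; rewrite mem_enum inE.
by under eq_bigr do rewrite !ffunE Hf.
Qed.
End lattice_points.

(** * Nets for the q-hull *)

(** Only the combinations themselves are covered, not their closure; [N] merely bounds the size of
    the net. *)
Definition hull_covered {R : realType} {X : lmodType R} (nrm : X -> R) (q : R)
    (n : nat) (g : 'I_n -> X) (N : nat) (e : R) : Prop :=
  exists Y : seq X, (size Y <= N)%N /\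
    forall c : 'I_n -> R, \sum_(j < n) `|c j| `^ q <= 1 ->
      exists2 y, y \in Y & nrm (\sum_(j < n) c j *: g j - y) <= e.

Section Lp_cover.
Context {d : measure_display} {T : measurableType d} {R : realType}.
Variables (mu : {measure set T -> \bar R}) (p : R) (p1 : 1 < p).
Variables (n : nat) (g : 'I_n -> Lp mu p1) (q : R).
Local Notation nrm := (@Lp_norm _ _ _ mu p p1).
Hypotheses (q01 : 0 < q <= 1) (gN : normalized_system nrm g).

(** A point of the closure is within [eta] of a combination, hence the enlarged radius. *)
Lemma entropy_number_le (k : nat) (e eta : R) :
  0 < eta -> hull_covered nrm q g (2 ^ k) e ->
  (entropy_number nrm k (A_class nrm q g) <= (e + eta)%:E)%E.
Proof.
move=> eta0 [Y [sY HY]]; apply: ereal_inf_lbound => /=; exists (e + eta) => //.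
(* The default [0] pads the list to exactly [2 ^ k] centres. *)
exists (fun j => nth 0 Y j) => x /(_ eta eta0) [a [c [c1 ->]] xa].
have [y yY ay] := HY c c1; set b := \sum_(j < n) _ in xa ay.
have yi : (index y Y < 2 ^ k)%N by apply: leq_trans sY; rewrite index_mem.
exists (Ordinal yi) => //=; rewrite /norm_cball /= nth_index //.
have -> : x - y = (b - y) + (x - b) by rewrite [RHS]addrC addrA subrK.
by apply: (le_trans (Lp_normD _ _)); rewrite lerD // ltW.
Qed.

Lemma hull_covered_mono (N N' : nat) (e e' : R) :
  (N <= N')%N -> e <= e' -> hull_covered nrm q g N e -> hull_covered nrm q g N' e'.
Proof.
move=> NN ee [Y [sY HY]]; exists Y; split; first exact: leq_trans NN.
by move=> c /HY[y yY ye]; exists y => //; exact: le_trans ee.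
Qed.

(** The origin suffices, by the triangle inequality and [|c_j| <= |c_j|^q], as [|c_j| <= 1]. *)
Lemma hull_covered_unit : hull_covered nrm q g 1 1.
Proof.
have /andP[q0 q1] := q01.
exists [:: 0]; split => // c c1; exists 0; rewrite ?mem_head // subr0.
have N0 : Lp_norm (0 : Lp mu p1) = 0 by rewrite -(scale0r 0) Lp_normZ normr0 mul0r.
apply: (@le_trans _ _ (\sum_(j < n) `|c j|)).
  elim/big_ind2 : _ => [|x a y b xa yb|j _]; first by rewrite N0.
    by apply: (le_trans (Lp_normD _ _)); exact: lerD.
  by rewrite Lp_normZ gN mulr1.
apply: (le_trans _ c1); apply: ler_sum => j _.
have : `|c j| `^ q <= 1.
  apply: (le_trans _ c1); rewrite (bigD1 j) //= lerDl sumr_ge0 // => i _; exact: powR_ge0.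
move=> cj; have {}cj : `|c j| <= 1.
  rewrite leNgt; apply/negP => cj1; move: cj; apply/negP; rewrite -ltNge.
  have := @gt0_ltr_powR _ q q0 1 `|c j|; rewrite !nnegrE powR1 => -> //.
have [->|c0] := eqVneq (c j) 0; first by rewrite normr0 powR_ge0.
by apply: ger1_powR; rewrite // normr_gt0 c0.
Qed.

(** Rescaling by [dl = M^(-1/q)]: rounding [y = c / dl] to [z] gives the net point
    [dl *: \sum_j z_j g_j], and the error is [dl] times the rounding error. *)
Lemma hull_covered_lattice (A M w lam s : R) (k : nat) :
  0 < M -> 1 <= A -> 1 <= w -> 0 < lam <= 1 -> 0 < s ->
  (forall y : 'I_n -> R,
    \sum_(j < n) `|y j| `^ q <= M ->
    exists2 z : 'I_n -> int,
      \sum_(j < n) `|(z j)%:~R : R| `^ q <= A * M &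
      Lp_norm (\sum_(j < n) ((z j)%:~R - y j) *: g j) <= A * w `^ Num.max 2^-1 p^-1) ->
  expR ((2 / q * s `^ q - ln lam) * (A * M)) * (1 + 2 * lam / s) ^+ n <= 2 ^+ k ->
  hull_covered nrm q g (2 ^ k) (A * M `^ (- q^-1) * w `^ Num.max 2^-1 p^-1).
Proof.
move=> M0 A1 w1 l01 s0 HR cnt; have /andP[q0 q1] := q01.
have AM : 0 <= A * M by rewrite mulr_ge0 // ?ltW // (lt_le_trans ltr01).
have [Z sZ HZ] := lattice_count n l01 s0 q01 AM.
pose dl := M `^ (- q^-1).
have dl0 : 0 < dl by exact: powR_gt0.
exists [seq dl *: \sum_(j < n) (z j)%:~R *: g j | z : {ffun 'I_n -> int} <- Z]; split.
  by rewrite size_map -(ler_nat R) natrX; apply: (le_trans sZ).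
move=> c c1; pose y j := c j / dl.
have yM : \sum_(j < n) `|y j| `^ q <= M.
  apply: (@le_trans _ _ (\sum_(j < n) M * `|c j| `^ q)).
    apply: ler_sum => j _; rewrite /y normrM powRM // mulrC ler_wpM2r ?powR_ge0 //.
    rewrite gtr0_norm ?invr_gt0 // /dl powRN invrK -powRrM mulVf ?gt_eqF //.
    by rewrite powRr1 // ltW.
  by rewrite -mulr_sumr -[leRHS]mulr1 ler_wpM2l // ltW.
have [z zB zN] := HR y yM.
exists (dl *: \sum_(j < n) (z j)%:~R *: g j).
  apply/mapP; exists [ffun j => z j]; first exact: HZ.
  by congr (_ *: _); apply: eq_bigr => j _; rewrite ffunE.
have -> : \sum_(j < n) c j *: g j - dl *: \sum_(j < n) (z j)%:~R *: g j =
    - dl *: \sum_(j < n) ((z j)%:~R - y j) *: g j.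
  rewrite !scaler_sumr -sumrB; apply: eq_bigr => j _.
  rewrite !scalerA -scalerBl; congr (_ *: _).
  by rewrite /y; field; rewrite gt_eqF.
rewrite Lp_normZ normrN gtr0_norm // [A * _]mulrC -mulrA.
by rewrite ler_wpM2l // ltW.
Qed.

End Lp_cover.

(** * Choice of parameters *)

Section rates.
Context {R : realType}.
Implicit Types (p q : R).

Lemma ln2_bounds : 2^-1 <= ln (2 : R) <= 1.
Proof.
apply/andP; split; last by have := @le_ln1Dx R 1; rewrite -[1 + 1]/(2 : R); apply; lra.
have := @le_ln1Dx R (- 2^-1); have -> : 1 + - 2^-1 = 2^-1 :> R by lra.
by rewrite lnV ?posrE // => h; have := h _; lra.
Qed.

Lemma log2_ge1 (k n : nat) : (0 < k)%N -> (k <= n)%N -> 1 <= log2 ((2 * n)%:R / k%:R : R).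
Proof.
move=> k0 kn; have /andP[l1 _] := ln2_bounds.
have k0' : 0 < k%:R :> R by rewrite ltr0n.
rewrite /log2 ler_pdivlMr; last by lra.
rewrite mul1r ler_ln ?posrE //; last first.
  by rewrite divr_gt0 // ltr0n muln_gt0 /= (leq_trans k0).
by rewrite ler_pdivlMr // -natrM ler_nat leq_mul2l kn.
Qed.

(* The factor [(10 E)^-2] is there to absorb the term [ln ((10 E)^2)] coming from [- ln M]. *)
Lemma sparse_count_exponent (E L : R) (k n : nat) :
  1 <= E -> (0 < k)%N -> (k <= n)%N -> L = log2 ((2 * n)%:R / k%:R) ->
  let M := (10 * E) ^- 2 * (k%:R / L) in
  0 < M <= n%:R /\ E * M * (1 - ln (M / n%:R)) <= k%:R * ln 2.
Proof.
move=> E1 k0 kn LE M.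
have /andP[l1 l2] := ln2_bounds.
have L1 : 1 <= L by rewrite LE log2_ge1.
have k0' : 0 < k%:R :> R by rewrite ltr0n.
have n0' : 0 < n%:R :> R by rewrite ltr0n (leq_trans k0).
have kn' : k%:R <= n%:R :> R by rewrite ler_nat.
have E0 : 0 < 10 * E by lra.
have L0 : 0 < L by lra.
pose c := (10 * E) ^- 2.
have c0 : 0 < c by rewrite invr_gt0 exprn_gt0.
have c1 : c <= 1 by rewrite invf_le1 ?exprn_gt0 // exprn_ege1 //; lra.
have kL : k%:R / L <= k%:R by rewrite ler_pdivrMr // ler_peMr // ltW.
have kL0 : 0 < k%:R / L by rewrite divr_gt0.
have M0 : 0 < M by rewrite mulr_gt0.
split.
  rewrite M0 /M -/c /=; apply: (@le_trans _ _ (1 * (k%:R / L))).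
    by rewrite ler_wpM2r // ltW.
  by rewrite mul1r (le_trans kL).
have lnE : ln (M / n%:R) = ln c + (ln k%:R - ln L) - ln n%:R.
  by rewrite ln_div ?posrE // /M lnM ?posrE // ln_div ?posrE.
have lnc : - ln c <= 2 * (10 * E).
  rewrite /c lnV ?posrE ?exprn_gt0 // opprK lnXn // [2 * _]mulr_natl lerMn2r /=.
  by rewrite ltW // ln_sublinear.
have lnL : ln L <= L by rewrite ltW // ln_sublinear.
have lnk : ln n%:R - ln k%:R <= L.
  have : L * ln 2 = ln 2 + ln n%:R - ln k%:R.
    rewrite LE /log2 mulfVK; last by rewrite gt_eqF //; lra.
    by rewrite ln_div ?posrE // ?natrM ?lnM ?posrE // mulr_gt0.
  nra.
(* The terms [1], [- ln c <= 20 * E], [ln L] and [ln n - ln k] are each compared with a multiple of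
   [L >= 1]. *)
have h1 : 1 - ln (M / n%:R) <= (3 + 20 * E) * L by rewrite lnE; nra.
have h2 : M * L = c * k%:R by rewrite /M -/c -mulrA divfK // gt_eqF.
have h3 : E * M * (1 - ln (M / n%:R)) <= E * M * ((3 + 20 * E) * L).
  by rewrite ler_wpM2l // mulr_ge0 // ltW //; lra.
apply: (le_trans h3).
have -> : E * M * ((3 + 20 * E) * L) = E * (3 + 20 * E) * (M * L) by ring.
rewrite h2 mulrA [k%:R * _]mulrC ler_pM2r //.
apply: le_trans l1.
(* [E * (3 + 20 * E) <= 50 * E^2], half of [(10 * E)^2]. *)
rewrite /c ler_pdivrMr ?exprn_gt0 // expr2; nra.
Qed.

End rates.

Lemma exp_ln2 (R : realType) (k : nat) : expR (k%:R * ln 2) = 2 ^+ k :> R.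
Proof. by rewrite expRM_natl lnK // posrE. Qed.

Lemma hull_covered_sparse (R : realType) (p q : R) (p1 : 1 < p) (q01 : 0 < q <= 1) :
  exists2 C : R, 0 < C & forall (d : measure_display) (T : measurableType d)
      (mu : {measure set T -> \bar R}) (n : nat) (g : 'I_n -> Lp mu p1) (k : nat),
    normalized_system (@Lp_norm _ _ _ mu p p1) g -> (0 < k)%N -> (k <= n)%N ->
    hull_covered (@Lp_norm _ _ _ mu p p1) q g (2 ^ k)
      (C * (log2 ((2 * n)%:R / k%:R) / k%:R) `^ (q^-1 - Num.max 2^-1 p^-1)).
Proof.
have [A A1 HA] := Lp_rounding p1.
have /andP[q0 q1] := q01.
pose m := Num.max 2^-1 p^-1; pose r := q^-1 - m.
have r0 : 0 <= r.
  rewrite subr_ge0 /m ge_max; have qi : 1 <= q^-1 by rewrite invf_ge1.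
  by apply/andP; split; apply: (le_trans _ qi); rewrite invf_le1 //; lra.
have Aq : 0 <= 2 / q * A by rewrite mulr_ge0 ?divr_ge0 ?(ltW q0) //; lra.
(* Large enough for [E0 * M * (1 - ln (M / n))] to dominate the exponent of the lattice count and
   the extra [2 * M]. *)
pose E0 := 2 / q * A + A + 2; have E01 : 1 <= E0 by rewrite /E0; lra.
pose c := (10 * E0) ^- 2; have c0 : 0 < c by rewrite invr_gt0 exprn_gt0 //; lra.
exists (A * c `^ - r) => [|d T mu n g k gN k0 kn].
  by rewrite mulr_gt0 ?powR_gt0 //; lra.
pose L : R := log2 ((2 * n)%:R / k%:R).
have [] := sparse_count_exponent E01 k0 kn (erefl L).
rewrite -/c; set M := c * _ => /andP[M0 Mn] HM.
have L0 : 0 < L by apply: lt_le_trans (log2_ge1 k0 kn).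
have k0' : 0 < k%:R :> R by rewrite ltr0n.
have n0' : 0 < n%:R :> R by apply: lt_le_trans Mn.
have eE : M `^ (- r) = c `^ (- r) * (L / k%:R) `^ r.
  have kL : 0 <= k%:R / L by rewrite divr_ge0 // ltW.
  rewrite /M (powRM _ (ltW c0) kL); congr (_ * _).
  by rewrite powRN -powR_inv1 ?powR_ge0 // powRAC powR_inv1 // invf_div.
rewrite -/L -/m -/r -mulrA -eE.
(* Rounding with [w = M] requires [M >= 1]; for [M <= 1] the claimed radius is at least [1], as
   [r >= 0]. *)
have [M1|M1] := leP M 1.
  apply: hull_covered_mono (hull_covered_unit q01 gN); first by rewrite expn_gt0.
  apply: (@le_trans _ _ (1 * 1)); first by rewrite mulr1.
  apply: ler_pM => //.
  rewrite powRN invf_ge1 ?powR_gt0 //.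
  by apply: (@le_trans _ _ (M `^ 0)); [apply: ger_powR; rewrite ?M0 ?M1|rewrite powRr0].
have -> : A * M `^ (- r) = A * M `^ (- q^-1) * M `^ m.
  rewrite -mulrA -powRD; last by rewrite (gt_eqF M0) implybT.
  by congr (_ * _ `^ _); rewrite /r; ring.
have lam01 : 0 < M / n%:R <= 1 by rewrite divr_gt0 //= ler_pdivrMr // mul1r.
(* With [lam = M / n] the factor [(1 + 2 * lam)^n] is at most [expR (2 * M)], at the price of the
   logarithm [- ln lam]. *)
apply: (hull_covered_lattice (lam := M / n%:R) (s := 1) q01 M0 A1 (ltW M1)) => //.
  move=> y yM; apply: (HA _ _ _ _ _ _ _ _ _ gN q01 M0 (ltW M1) yM).
  by apply: le_trans yM; apply: ler_sum => j _; exact: rounding_var_le_powR.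
have h : (1 + 2 * (M / n%:R) / 1) ^+ n <= expR (2 * M).
  have -> : 2 * M = n%:R * (2 * (M / n%:R) / 1) by field; rewrite gt_eqF.
  rewrite expRM_natl; apply: lerXn2r; rewrite ?nnegrE ?expR_ge0 ?expR_ge1Dx //.
  by rewrite divr1 addr_ge0 // mulr_ge0 // divr_ge0 // ltW.
apply: (le_trans (ler_wpM2l (expR_ge0 _) h)).
rewrite -expRD -exp_ln2 ler_expR; apply: le_trans HM.
have lnM0 := ln_le0 (andP lam01).2.
rewrite powR1 mulr1; set l := ln _ in lnM0 *.
have h1 : 0 <= - l * M by rewrite mulr_ge0 ?oppr_ge0 // ltW.
have h2 := mulr_ge0 Aq h1.
have h3 : 0 <= A * M by rewrite mulr_ge0 //; lra.
have -> : E0 * M * (1 - l) =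
    (2 / q - l) * (A * M) + 2 * M + (2 / q * A * (- l * M) + A * M + 2 * (- l * M)).
  by rewrite /E0; ring.
by rewrite lerDl; lra.
Qed.

Lemma hull_covered_dense (R : realType) (p q : R) (p1 : 1 < p) (q01 : 0 < q <= 1) :
  exists2 C : R, 0 < C & forall (d : measure_display) (T : measurableType d)
      (mu : {measure set T -> \bar R}) (n : nat) (g : 'I_n -> Lp mu p1) (k : nat),
    normalized_system (@Lp_norm _ _ _ mu p p1) g -> (0 < n)%N -> (n <= k)%N ->
    hull_covered (@Lp_norm _ _ _ mu p p1) q g (2 ^ k)
      (C * (2 `^ (- (k%:R / n%:R)) * n%:R `^ (Num.max 2^-1 p^-1 - q^-1))).
Proof.
have [A A1 HA] := Lp_rounding p1.
have [C C0 HC] := hull_covered_sparse p1 q01.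
have /andP[q0 q1] := q01.
pose m := Num.max 2^-1 p^-1.
(* For [s <= 1], [1 + 2 / s <= 3 / s]; this [G] makes [expR (2 / q * A) * 3 / s] equal to
   [2^(k/n)]. *)
pose G := 3 * expR (2 / q * A).
have G0 : 0 < G by rewrite mulr_gt0 // expR_gt0.
have A0 : 0 < A by lra.
exists ((A + C) * G) => [|d T mu n g k gN n0 nk]; first by rewrite mulr_gt0 //; lra.
have n0' : 0 < n%:R :> R by rewrite ltr0n.
have n1 : 1 <= n%:R :> R by rewrite ler1n.
pose s := G * 2 `^ (- (k%:R / n%:R)).
have s0 : 0 < s by rewrite mulr_gt0 // powR_gt0.
have nm0 := powR_ge0 (n%:R : R) (m - q^-1).
rewrite -/m.
have -> : (A + C) * G * (2 `^ (- (k%:R / n%:R)) * n%:R `^ (m - q^-1)) =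
    A * s * n%:R `^ (m - q^-1) + C * s * n%:R `^ (m - q^-1).
  by rewrite /s; ring.
(* If [s > 1], then [2^(k/n) < G], and the sparse net for [k = n] loses only a constant factor. *)
have [s1|s1] := leP s 1; last first.
  apply: hull_covered_mono (HC _ _ _ _ _ n gN n0 (leqnn n)).
    by rewrite leq_pexp2l.
  have -> : log2 ((2 * n)%:R / n%:R : R) = 1.
    rewrite natrM mulfK ?gt_eqF // /log2 divff // gt_eqF //.
    by have /andP[] := @ln2_bounds R; lra.
  rewrite div1r -powR_inv1 ?(ltW n0') // -powRrM mulN1r opprB -/m.
  apply: (@le_trans _ _ (C * s * n%:R `^ (m - q^-1))); last first.
    by rewrite lerDr !mulr_ge0 // ltW.
  by rewrite ler_wpM2r // ler_peMr // ltW.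
pose M := n%:R * s `^ (- q).
have M0 : 0 < M by rewrite mulr_gt0 ?powR_gt0.
have Mq : M `^ (- q^-1) = n%:R `^ (- q^-1) * s.
  rewrite powRM ?powR_ge0 ?(ltW n0') // -powRrM mulrNN mulfV ?gt_eqF //.
  by rewrite powRr1 // ltW.
apply: (@hull_covered_mono _ _ _ _ _ _ _ _ _ (2 ^ k) _ (A * M `^ (- q^-1) * n%:R `^ m)) => //.
  rewrite Mq powRD; last by rewrite (gt_eqF n0') implybT.
  set X := n%:R `^ m; set Y := n%:R `^ (- q^-1).
  have -> : A * (Y * s) * X = A * s * (X * Y) by ring.
  by rewrite lerDl !mulr_ge0 ?powR_ge0 // ltW.
apply: (hull_covered_lattice (lam := 1) (s := s) q01 M0 A1 n1) => //.
- by rewrite ltr01 lexx.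
- move=> y yM; apply: (HA _ _ _ _ _ _ _ _ _ gN q01 M0 n1 yM).
  apply: (@le_trans _ _ (\sum_(j < n) 1)); last by rewrite sumr_const card_ord.
  by apply: ler_sum => j _; exact: rounding_var_le1.
rewrite ln1 subr0.
(* The powers of [s] cancel, so the exponent is linear in [n] and the count is an n-th power. *)
have -> : 2 / q * s `^ q * (A * M) = n%:R * (2 / q * A).
  have sq : s `^ q * s `^ (- q) = 1 by rewrite powRN divff // gt_eqF // powR_gt0.
  have -> : 2 / q * s `^ q * (A * M) = n%:R * (2 / q * A) * (s `^ q * s `^ (- q)).
    by rewrite /M; ring.
  by rewrite sq mulr1.
rewrite expRM_natl -exprMn.
have -> : 2 ^+ k = (2 `^ (k%:R / n%:R)) ^+ n :> R.
  by rewrite -[RHS]powR_mulrn ?powR_ge0 // -powRrM divfK ?gt_eqF // powR_mulrn.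
apply: lerXn2r; rewrite ?nnegrE ?powR_ge0 //.
  by rewrite mulr_ge0 ?expR_ge0 // addr_ge0 // mulr_ge0 ?invr_ge0 ?ltW //; lra.
have -> : 2 `^ (k%:R / n%:R) = G / s :> R.
  by rewrite /s invfM mulrA mulfV ?gt_eqF // mul1r powRN invrK.
have -> : G / s = expR (2 / q * A) * (3 / s) by rewrite /G; ring.
rewrite ler_wpM2l ?expR_ge0 //.
have si : 1 <= s^-1 by rewrite invf_ge1.
by rewrite mulr1; lra.
Qed.

Unset Implicit Arguments.

Theorem corollary3p3 (R : realType) (q p : R) (q0 : 0 < q) (q1 : q <= 1)
    (p1 : 1 < p) :
  exists C : R,
    forall (d : measure_display) (T : measurableType d)
           (mu : {measure set T -> \bar R})
           (n : nat) (g : 'I_n -> Lp mu p1) (k : nat),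
      (0 < n)%N ->
      normalized_system (@Lp_norm _ _ _ mu p p1) g ->
      Lp_distinct g ->
      (1 <= k)%N ->
      ((k <= n)%N ->
        (entropy_number (@Lp_norm _ _ _ mu p p1) k (A_class (@Lp_norm _ _ _ mu p p1) q g)
         <= (C * (log2 ((2 * n)%:R / k%:R) / k%:R)
                   `^ (q^-1 - Num.max 2^-1 p^-1))%:E)%E) /\
      ((n <= k)%N ->
        (entropy_number (@Lp_norm _ _ _ mu p p1) k (A_class (@Lp_norm _ _ _ mu p p1) q g)
         <= (C * (2 `^ (- (k%:R / n%:R)) * n%:R `^ (Num.max 2^-1 p^-1 - q^-1)))%:E)%E).
Proof.
have q01 : 0 < q <= 1 by rewrite q0.
have [C1 C10 H1] := hull_covered_sparse p1 q01.
have [C2 C20 H2] := hull_covered_dense p1 q01.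
(* The factor [2] pays for the closure: [eta] is taken equal to the radius of the net. *)
exists (2 * (C1 + C2)) => d T mu n g k n0 gN _ k0.
have nE (C b : R) : 0 < C -> C <= C1 + C2 -> 0 < b ->
    hull_covered (@Lp_norm _ _ _ mu p p1) q g (2 ^ k) (C * b) ->
    (entropy_number (@Lp_norm _ _ _ mu p p1) k (A_class (@Lp_norm _ _ _ mu p p1) q g)
      <= (2 * (C1 + C2) * b)%:E)%E.
  move=> C0 CC b0 H; have Cb : 0 < C * b by rewrite mulr_gt0.
  apply: (le_trans (entropy_number_le Cb H)); rewrite lee_fin.
  by have := ler_wpM2r (ltW b0) CC; lra.
split=> [kn|nk].
  apply: (nE C1) => //; [by rewrite lerDl ltW| |exact: H1].
  by rewrite powR_gt0 // divr_gt0 ?ltr0n // (lt_le_trans ltr01) // log2_ge1.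
apply: (nE C2) => //; [by rewrite lerDr ltW| |exact: H2].
by rewrite mulr_gt0 ?powR_gt0 // ltr0n.
Qed.
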